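(* For each integer $n\ge 1$ let $\pi$ be a uniformly random permutation of the set $\{0,1,\dots,2^n-1\}$. Let $\gamma_\pi(s)$ be the eigenvalue gap between the two lowest energy levels of $H_\pi(s)$, and let $$g_\pi=\min_{0\le s\le 1}\gamma_\pi(s).$$ Then $$\Pr\left[g_\pi\le n^2\,2^{-n/6}\right]\longrightarrow 1\quad\text{as } n\to\infty.$$
   Context: Fix $n\ge1$. Identify the integers $z\in\{0,1,\dots,2^n-1\}$ with $n$-bit strings via binary expansion, and let $W(z)$ be the Hamming weight of $z$ (the number of ones in the string). Let $\{|z\rangle\}$ be the standard orthonormal basis of $(\mathbb{C}^2)^{\otimes n}\cong\mathbb{C}^{2^n}$ indexed by $n$-bit strings. Let $\sigma_x^i$ be the Pauli $x$ operator acting on the $i$-th qubit, i.e. $\sigma_x^i|z\rangle=|z\oplus e_i\rangle$, where $z\oplus e_i$ is $z$ with its $i$-th bit flipped. For a permutation $\pi$ of $\{0,1,\dots,2^n-1\}$ (a permutation of the $2^n$ strings, not of the $n$ bits) and real $s$, define the Hermitian operator $$H_\pi(s)=(1-s)\sum_{i=1}^n\left(\frac{1-\sigma_x^i}{2}\right)+s\sum_{z=0}^{2^n-1}W(\pi^{-1}(z))\,|z\rangle\langle z|.$$ The gap $\gamma_\pi(s)$ is the second smallest minus the smallest eigenvalue of $H_\pi(s)$, eigenvalues being counted with multiplicity. Probabilities are over $\pi$ chosen uniformly from all $(2^n)!$ permutations. *)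

(* Defs.v *)
From mathcomp Require Import all_boot all_order all_algebra all_fingroup.
From mathcomp Require Import all_classical all_reals all_analysis.
From mathcomp Require Import complex.

Set Implicit Arguments.
Unset Strict Implicit.
Unset Printing Implicit Defensive.

Import Order.TTheory GRing.Theory Num.Theory.
Import numFieldNormedType.Exports.

Local Open Scope classical_set_scope.
Local Open Scope complex_scope.
Local Open Scope ring_scope.

Definition bits n (z : 'I_(2 ^ n)%N) : {ffun 'I_n -> bool} :=
  [ffun i : 'I_n => odd (z %/ 2 ^ i)%N].

Definition flip n (i : 'I_n) (b : {ffun 'I_n -> bool}) : {ffun 'I_n -> bool} :=
  [ffun j => b j (+) (j == i)].

Definition weight n (z : 'I_(2 ^ n)%N) : nat := (\sum_(i < n) bits z i)%N.

Definition sigmax (R : realType) n (i : 'I_n) : 'M[R[i]]_(2 ^ n)%N :=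
  \matrix_(w, z) (bits w == flip i (bits z))%:R.

Definition hamiltonian (R : realType) n (pi : 'S_(2 ^ n)%N) (s : R) :
    'M[R[i]]_(2 ^ n)%N :=
  (1 - s)%:C *: (\sum_(i < n) 2^-1 *: (1%:M - sigmax R i))
  + s%:C *: diag_mx (\row_z (weight ((pi^-1)%g z))%:R).

(* All roots of the characteristic polynomial, repeated according to their
   multiplicity.  They are real when [A] is Hermitian, in which case taking
   real parts only changes their type. *)
Definition eigenvalues (R : realType) m (A : 'M[R[i]]_m) : seq R :=
  sort <=%R [seq complex.Re l
            | l <- sval (closed_field_poly_normal (char_poly A))].

Definition gap (R : realType) n (pi : 'S_(2 ^ n)%N) (s : R) : R :=
  let e := eigenvalues (hamiltonian pi s) in e`_1 - e`_0.

(* The infimum is attained: the ordered eigenvalues of a Hermitian matrix depend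
   continuously on it, and [0, 1] is compact. *)
Definition min_gap (R : realType) n (pi : 'S_(2 ^ n)%N) : R :=
  inf [set gap pi s | s in `[0 : R, 1]].

Definition prob_perm (R : realType) m (E : pred 'S_m) : R :=
  #|E|%:R / #|{: 'S_m}|%:R.

(* Main.v *)
(* Let x0 = pi 0 be the string of cost 0, let c >= 1 be the most frequent
   positive weight, and let H' be H with the cost of x0 raised to c.  Since H'
   does not distinguish x0 from the at least 2^n / n - 1 other strings of cost
   c, its ground state phi has |phi x0|^2 <= b^2 at all points k / M of a net of
   [0, 1], except with probability O(M n / (b^2 2^n)).
   Let D = E0(H') - E0(H).  It vanishes at s = 0, is at least 1 at s = 1 and
   moves by at most 2 n / M along the net, so at some net point
   2 n b <= D <= 2 n b + 2 n / M.  There, phi is nearly orthogonal to the ground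
   state of H because |phi x0| is small compared with D, while its H-energy
   exceeds E0(H) by at most D; so the gap of H is at most 2 D.  Taking b and
   1 / M of order 2^(-n/6), up to powers of n, makes the exceptional probability
   tend to 0. *)
Require Import Defs.
From mathcomp Require Import all_boot all_order all_algebra all_fingroup.
From mathcomp Require Import all_classical all_reals all_analysis.
From mathcomp Require Import complex ring lra.

Import Order.TTheory GRing.Theory Num.Theory.
Import numFieldNormedType.Exports.

Set Implicit Arguments.
Unset Strict Implicit.
Unset Printing Implicit Defensive.

Local Open Scope classical_set_scope.
Local Open Scope ring_scope.

(** * Spectral decomposition and variational bounds *)

Local Notation "''[' u , v ]" := (dotmx u v) (format "''[' u ,  v ]").
Local Notation "''[' u ]" := (dotmx u u) (format "''[' u ]").

Lemma char_poly_conj (F : fieldType) m (P D : 'M[F]_m) :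
  P \in unitmx -> char_poly (invmx P *m D *m P) = char_poly D.
Proof.
move=> uP; rewrite /char_poly.
have PVP : map_mx polyC (invmx P) *m map_mx polyC P = 1%:M.
  by rewrite -map_mxM mulVmx // map_mx1.
have -> : char_poly_mx (invmx P *m D *m P) =
    map_mx polyC (invmx P) *m char_poly_mx D *m map_mx polyC P.
  rewrite /char_poly_mx mulmxBr mulmxBl -!map_mxM; congr (_ - _).
  by rewrite -mulmxA mul_scalar_mx -scalemxAr PVP scalemx1.
by rewrite !det_mulmx mulrAC -det_mulmx PVP det1 mul1r.
Qed.

(** The spectral theorem orders the eigenvalues arbitrarily, while [eigenvalues] sorts the roots of
    the characteristic polynomial. Permuting the rows of the unitary matrix reconciles the two. *)
Lemma hermsym_diagonalize (R : realType) m (A : 'M[R[i]%C]_m) :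
  A \is hermsymmx -> exists P : 'M[R[i]%C]_m, P \is unitarymx /\
    P *m A = diag_mx (\row_k ((eigenvalues A)`_k)%:C%C) *m P.
Proof.
move=> hA; pose d := spectral_diag A; pose Q := spectralmx A.
have uQ : Q \is unitarymx by exact: spectral_unitarymx.
have QA : A = invmx Q *m diag_mx d *m Q.
  exact/orthomx_spectralP/hermitian_normalmx.
have dR k : ((complex.Re (d 0 k))%:C)%C = d 0 k.
  by apply: RRe_real; have /mxOverP := hermitian_spectral_diag_real hA.
(* Both lists factor the same monic polynomial into linear factors, so they agree up to order. *)
have /tuple_permP[p pE] : perm_eq (eigenvalues A) [tuple complex.Re (d 0 k) | k < m].
  rewrite /eigenvalues perm_sort.
  have -> : tval [tuple complex.Re (d 0 k) | k < m] =
      [seq complex.Re l | l <- [seq d 0 k | k <- enum 'I_m]].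
    by rewrite -map_comp.
  apply: perm_map; apply: prod_XsubC_eq.
  case: (closed_field_poly_normal (char_poly A)) => r /= rE.
  move: rE; rewrite (monicP (char_poly_monic A)) scale1r => <-.
  rewrite {1}QA char_poly_conj ?unitarymx_unit // char_poly_trig ?diag_mx_is_trig //.
  rewrite big_map enumT; apply: eq_bigr => k _.
  by rewrite mxE eqxx mulr1n.
exists (row_perm p Q); split.
  have -> : row_perm p Q = perm_mx p *m Q by rewrite row_permE.
  apply: (mul_unitarymx _ uQ); apply/unitarymxP.
  by rewrite tr_perm_mx map_perm_mx -perm_mxM mulgV perm_mx1.
apply/row_matrixP => k; rewrite !row_mul row_diag_mx -scalemxAl -rowE mxE.
have -> : (((eigenvalues A)`_k)%:C)%C = d 0 (p k).
  by rewrite pE -tnth_nth !tnth_mktuple dR.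
have -> : row k (row_perm p Q) = row (p k) Q by apply/rowP => j; rewrite !mxE.
rewrite {1}QA 2!mulmxA -[row (p k) Q *m invmx Q]row_mul mulmxV ?unitarymx_unit //.
by rewrite row1 -rowE row_diag_mx -scalemxAl -rowE.
Qed.

(** * The Hermitian form on row vectors *)

Section RowVectors.
Variables (C : numClosedFieldType) (m : nat).
Implicit Types (A B P : 'M[C]_m) (x y : 'rV[C]_m).

Lemma hermsymP A : reflect (A^t* = A)%sesqui (A \is hermsymmx).
Proof.
by apply: (iffP (is_hermitianmxP _ _ _)); rewrite expr0 scale1r => /esym.
Qed.

Lemma dotmx_mul_hermsym A x y : A \is hermsymmx -> '[x *m A, y] = '[x, y *m A].
Proof.
by move=> /hermsymP hA; rewrite !dotmxE trmx_mul map_mxM /= hA mulmxA.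
Qed.

(** Parseval's identity: the rows of [P] form an orthonormal basis. *)
Lemma dotmx_unitary P x y : P \is unitarymx ->
  '[x, y] = \sum_i '[x, row i P] * ('[y, row i P])^*.
Proof.
move=> uP; have coord (z : 'rV_m) i : (z *m P^t*%sesqui) 0 i = '[z, row i P].
  by rewrite dotmxE !mxE; apply: eq_bigr => j _; rewrite !mxE.
have -> : '[x, y] = '[x *m P^t*%sesqui *m P, y] by rewrite mulmxKtV.
rewrite dotmxE -mulmxA.
have -> : (P *m y^t* = (y *m P^t*)^t*)%sesqui.
  by rewrite trmx_mul map_mxM trmxCK.
by rewrite mxE; apply: eq_bigr => i _; rewrite coord 2!mxE coord.
Qed.

Lemma hermsymD A B :
  A \is hermsymmx -> B \is hermsymmx -> A + B \is hermsymmx.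
Proof.
move=> /hermsymP hA /hermsymP hB; apply/hermsymP.
by rewrite linearD /= map_mxD hA hB.
Qed.

Lemma hermsymZ (a : C) A :
  a \is Num.real -> A \is hermsymmx -> a *: A \is hermsymmx.
Proof.
move=> /CrealP ra /hermsymP hA; apply/hermsymP.
by rewrite linearZ /= map_mxZ hA /= ra.
Qed.

Lemma hermsym1 : (1%:M : 'M[C]_m) \is hermsymmx.
Proof. by apply/hermsymP; rewrite trmx1 map_mx1. Qed.

Lemma hermsym_sum I (r : seq I) (F : I -> 'M[C]_m) :
  (forall i, F i \is hermsymmx) -> \sum_(i <- r) F i \is hermsymmx.
Proof.
move=> hF; apply: (big_ind (fun A => A \is hermsymmx)) => //; last exact: hermsymD.
by apply/hermsymP; rewrite trmx0 map_mx0.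
Qed.

Lemma hermsym_diag (d : 'rV[C]_m) : d \is a realmx -> diag_mx d \is hermsymmx.
Proof.
by move=> rd; apply/hermsymP; rewrite tr_diag_mx map_diag_mx realmxC.
Qed.

Lemma dotmx_diag (d x : 'rV[C]_m) :
  '[x *m diag_mx d, x] = \sum_j d 0 j * `|x 0 j| ^+ 2.
Proof.
rewrite dotmxE mxE; apply: eq_bigr => j _.
by rewrite mul_mx_diag !mxE normCK mulrA [d 0 j * _]mulrC.
Qed.

Lemma dotmx_sum x : '[x] = \sum_j `|x 0 j| ^+ 2.
Proof.
by rewrite dotmxE mxE; apply: eq_bigr => j _; rewrite !mxE normCK.
Qed.

End RowVectors.

Section Variational.
Variables (R : realType) (m : nat).
Local Notation C := R[i]%C.
Implicit Types (A B : 'M[C]_m) (x y : 'rV[C]_m).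

Lemma size_eigenvalues A : size (eigenvalues A) = m.
Proof.
rewrite /eigenvalues size_sort size_map.
case: (closed_field_poly_normal (char_poly A)) => r /= rE.
apply: succn_inj; rewrite -(size_char_poly A) rE.
rewrite (monicP (char_poly_monic A)) scale1r.
by rewrite size_prod_XsubC.
Qed.

Lemma eigenvalues_le A i j : (i <= j < m)%N ->
  (eigenvalues A)`_i <= (eigenvalues A)`_j.
Proof.
move=> /andP[ij jm].
apply: (sorted_leq_nth le_trans le_refl) => //; last 2 first.
- by rewrite inE size_eigenvalues (leq_ltn_trans ij).
- by rewrite inE size_eigenvalues.
- exact: sort_le_sorted.
Qed.

(* For [m = 1] the second eigenvalue is the junk value [0], but its coefficient
   vanishes. *)
Lemma ground_state A : A \is hermsymmx -> (0 < m)%N ->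
  exists psi : 'rV[C]_m, [/\ '[psi] = 1,
    psi *m A = (((eigenvalues A)`_0)%:C)%C *: psi,
    forall x, (((eigenvalues A)`_0)%:C)%C * '[x] <= '[x *m A, x] &
    forall x, (((eigenvalues A)`_0)%:C)%C * `|'[x, psi]| ^+ 2 +
      (((eigenvalues A)`_1)%:C)%C * ('[x] - `|'[x, psi]| ^+ 2) <= '[x *m A, x]].
Proof.
move=> hA m0; have [P [uP PA]] := hermsym_diagonalize hA.
pose k0 := Ordinal m0; set e := eigenvalues A in PA *.
have uPrd i : '[row i P] = 1.
  by have /row_unitarymxP/(_ i i) := uP; rewrite eqxx.
have rowA i : row i P *m A = (e`_i)%:C%C *: row i P.
  by rewrite -row_mul PA row_mul row_diag_mx -scalemxAl -rowE mxE.
have norm2 x : '[x] = \sum_(i < m) `|'[x, row i P]| ^+ 2.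
  by rewrite (dotmx_unitary _ _ uP); apply: eq_bigr => i _; rewrite normCK.
have energy x : '[x *m A, x] = \sum_(i < m) (e`_i)%:C%C * `|'[x, row i P]| ^+ 2.
  rewrite (dotmx_unitary _ _ uP); apply: eq_bigr => i _.
  rewrite dotmx_mul_hermsym // rowA linearZr_LR /= normCK mulrA.
  by congr (_ * _ * _); exact: conjc_real.
exists (row k0 P); split => // x; rewrite energy norm2.
  rewrite mulr_sumr; apply: ler_sum => i _.
  by rewrite ler_wpM2r ?exprn_ge0 // lecR; apply: eigenvalues_le; rewrite ltn_ord.
(* The component along [psi] cancels; all other components carry eigenvalues of index at least 1. *)
rewrite (bigD1 k0) //= [in leRHS](bigD1 k0) //= addrAC subrr add0r lerD2l.
rewrite mulr_sumr; apply: ler_sum => i ik0.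
rewrite ler_wpM2r ?exprn_ge0 // lecR; apply: eigenvalues_le.
by rewrite ltn_ord andbT lt0n.
Qed.

End Variational.

(** * Comparing ground energies and raising one diagonal entry *)

Section RankOne.
Variables (R : realType) (m : nat).
Local Notation C := R[i]%C.
Implicit Types (A B : 'M[C]_m) (x y : 'rV[C]_m).

(** The ground state of [B] serves as a trial state for [A]. *)
Lemma ground_energy_le A B (k : R) : A \is hermsymmx -> B \is hermsymmx ->
  (0 < m)%N -> (forall x, '[x *m (A - B), x] <= k%:C%C * '[x]) ->
  (eigenvalues A)`_0 <= (eigenvalues B)`_0 + k.
Proof.
move=> hA hB m0 AB.
have [_ [_ _ /(_ _) rA _]] := ground_state hA m0.
have [phi [phi1 phiB _ _]] := ground_state hB m0.
have := rA phi; rewrite phi1 mulr1 => /le_trans le_phi.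
rewrite -lecR; apply: le_phi; have := AB phi.
rewrite mulmxBr linearBl /= phiB linearZl_LR /= phi1 !mulr1 lerBlDr addrC.
by rewrite -rmorphD.
Qed.

Lemma dotmx_delta x y k : '[x *m delta_mx k k, y] = x 0 k * (y 0 k)^*.
Proof.
have -> : x *m delta_mx k k = x 0 k *: delta_mx 0 k.
  apply/rowP => j; rewrite !mxE (bigD1 k) //= big1 ?addr0 => [|l lk].
    by rewrite !mxE eqxx.
  by rewrite !mxE (negPf lk) mulr0.
rewrite linearZl_LR /=; congr (_ * _); rewrite dotmxE mxE (bigD1 k) //=.
rewrite !mxE !eqxx mul1r big1 ?addr0 // => j jk.
by rewrite !mxE (negPf jk) andbF mul0r.
Qed.

Lemma norm_coord_le x k : `|x 0 k| ^+ 2 <= '[x].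
Proof.
rewrite dotmxE mxE (bigD1 k) //= !mxE -normCK lerDl.
by apply: sumr_ge0 => j _; rewrite !mxE mul_conjC_ge0.
Qed.

(* Pairing the two eigenvector equations gives
   [(E' - E) <phi, psi> = lam phi(k) psi(k)^*], where [psi] is the ground state
   of [A].  A small [phi k] thus makes [phi] almost orthogonal to [psi], and
   [phi] is then a trial state for the second eigenvalue. *)
Lemma gap_rank_one A (k : 'I_m) (lam E' : R) (phi : 'rV[C]_m) :
  let e := eigenvalues A in
  A \is hermsymmx -> (1 < m)%N -> 0 <= lam -> '[phi] = 1 ->
  phi *m (A + lam%:C%C *: delta_mx k k) = E'%:C%C *: phi ->
  e`_0 < E' ->
  (4 * lam ^+ 2)%:C%C * `|phi 0 k| ^+ 2 <= ((E' - e`_0) ^+ 2)%:C%C ->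
  e`_1 - e`_0 <= 2 * (E' - e`_0).
Proof.
move=> e hA m1 lam0 phi1 phiE eE' small.
have [psi [psi1 psiA _ psi2]] := ground_state hA (ltnW m1).
rewrite -/e in psiA psi2.
have overlap : (E' - e`_0)%:C%C * '[phi, psi] =
    lam%:C%C * (phi 0 k * (psi 0 k)^*).
  have := congr1 (fun z => '[z, psi]) phiE.
  rewrite /= mulmxDr linearDl /= dotmx_mul_hermsym // psiA linearZr_LR /=.
  rewrite -scalemxAr !linearZl_LR /= dotmx_delta rmorphB mulrBl => <-.
  rewrite [X in X * _]conjc_real; ring.
have [r rE] : exists r, `|'[phi, psi]| ^+ 2 = r%:C%C.
  by apply/complex_realP; rewrite ger0_real // exprn_ge0.
have r0 : 0 <= r by rewrite -lecR -rE exprn_ge0.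
(* The [A]-energy of [phi] is [E'] minus a nonnegative term, and [psi2] bounds it from below. *)
have le_energy : e`_0 * r + e`_1 * (1 - r) <= E'.
  have := psi2 phi; rewrite phi1 rE.
  have -> : '[phi *m A, phi] = E'%:C%C - lam%:C%C * `|phi 0 k| ^+ 2.
    have := congr1 (fun z => '[z, phi]) phiE.
    rewrite /= mulmxDr linearDl /= -scalemxAr !linearZl_LR /= dotmx_delta.
    by rewrite phi1 mulr1 -normCK => <-; rewrite addrK.
  move=> h; rewrite -lecR.
  have -> : (e`_0 * r + e`_1 * (1 - r))%:C%C =
      (e`_0)%:C%C * r%:C%C + (e`_1)%:C%C * (1 - r%:C%C) :> C.
    by rewrite rmorphD !rmorphM rmorphB.
  apply: le_trans h _; rewrite gerBl mulr_ge0 ?exprn_ge0 //.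
  by rewrite lecR.
have dpos : 0 < E' - e`_0 by rewrite subr_gt0.
(* Square the modulus of [overlap]; the entry of the unit vector [psi] has modulus at most 1, and
   [small] bounds the rest. *)
have le_r : 4 * ((E' - e`_0) ^+ 2 * r) <= (E' - e`_0) ^+ 2.
  rewrite -lecR; apply: le_trans small.
  have := congr1 (fun z => `|z| ^+ 2) overlap.
  have normR (a : R) : 0 <= a -> `|a%:C%C| = a%:C%C.
    by move=> a0; rewrite ger0_norm // ler0c.
  rewrite /= !normrM !exprMn norm_conjC rE !normR // ?(ltW dpos) // => ov.
  have -> : (4 * ((E' - e`_0) ^+ 2 * r))%:C%C =
      4%:C%C * (((E' - e`_0)%:C%C) ^+ 2 * r%:C%C) :> C.
    by rewrite -rmorphXn -!rmorphM.
  have -> : (4 * lam ^+ 2)%:C%C = 4%:C%C * (lam%:C%C) ^+ 2 :> C.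
    by rewrite -rmorphXn -rmorphM.
  rewrite ov -mulrA; apply: ler_wpM2l; first by rewrite ler0c.
  rewrite mulrA ler_piMr //.
    by apply: mulr_ge0; apply: exprn_ge0; [rewrite ler0c | exact: normr_ge0].
  by rewrite -psi1 norm_coord_le.
have e01 : e`_0 <= e`_1 by apply: eigenvalues_le.
have r4 : 4 * r <= 1.
  rewrite -(ler_pM2l (exprn_gt0 2 dpos)) mulr1; apply: le_trans le_r.
  by rewrite le_eqVlt; apply/orP; left; apply/eqP; ring.
(* Subtracting [e]_0[from]le_energy[gives](1 - r) * (e[_1 - e]_0) <= E' - e[_0], where [1 - r] is at
   least 3/4. *)
nra.
Qed.

End RankOne.

(** * The Hamiltonians *)

(** Induction on the number of bits: parity recovers the lowest bit, and halving shifts the others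
    down. *)
Lemma bits_inj n : injective (@bits n).
Proof.
move=> z w /ffunP zw; apply: val_inj => /=.
have {}zw i : (i < n)%N -> odd (z %/ 2 ^ i) = odd (w %/ 2 ^ i).
  by move=> ilt; have := zw (Ordinal ilt); rewrite !ffunE.
move: (nat_of_ord z) (nat_of_ord w) (ltn_ord z) (ltn_ord w) zw => {z w}.
elim: n => [|n IHn] a b; first by rewrite expn0 !ltnS !leqn0 => /eqP -> /eqP ->.
rewrite expnS => ha hb ab.
have h0 : odd a = odd b by have := ab 0 isT; rewrite expn0 !divn1.
rewrite -[a]odd_double_half -[b]odd_double_half h0; congr (_ + _.*2)%N.
apply: IHn => [||i ilt].
- by rewrite -divn2 ltn_divLR // mulnC.
- by rewrite -divn2 ltn_divLR // mulnC.
- by rewrite -!divn2 -!divnMA -expnS; apply: ab.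
Qed.

Lemma bits_bij n : bijective (@bits n).
Proof.
by apply: inj_card_bij (@bits_inj n) _; rewrite card_ffun card_bool !card_ord.
Qed.

Lemma flipK n i : involutive (@flip n i).
Proof. by move=> b; apply/ffunP => j; rewrite !ffunE addbK. Qed.

Definition zero_string n : 'I_(2 ^ n) := Ordinal (expn_gt0 2 n).

Lemma bits_zero n i : bits (zero_string n) i = false.
Proof. by rewrite ffunE div0n. Qed.

Lemma weight_zero n : weight (zero_string n) = 0%N.
Proof. by rewrite /weight big1 // => i _; rewrite bits_zero. Qed.

Lemma weight_gt0 n z : z != zero_string n -> (0 < weight z)%N.
Proof.
apply: contraNT; rewrite -eqn0Ngt sum_nat_eq0 => /forallP z0.
apply/eqP/bits_inj/ffunP => i; rewrite bits_zero.
by have := z0 i; rewrite eqb0 => /negPf.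
Qed.

Lemma weight_le n (z : 'I_(2 ^ n)) : (weight z <= n)%N.
Proof.
rewrite -{2}[n]card_ord -sum1_card; apply: leq_sum => i _.
by case: (bits z i).
Qed.

Section Hamiltonians.
Variables (R : realType) (n : nat).
Local Notation N := (2 ^ n)%N.
Local Notation C := R[i]%C.

Lemma sigmax_hermsym (i : 'I_n) : sigmax R i \is hermsymmx.
Proof.
apply/hermsymP/matrixP => w z; rewrite !mxE conjC_nat.
by rewrite eq_sym (inv_eq (flipK i)).
Qed.

Lemma sigmax_sqr (i : 'I_n) : sigmax R i *m sigmax R i = 1%:M :> 'M[C]_N.
Proof.
have [g bitsK gK] := bits_bij n.
apply/matrixP => w z; rewrite !mxE (bigD1 (g (flip i (bits z)))) //= big1.
  rewrite !mxE gK eqxx mulr1 addr0 flipK; congr (_%:R); congr nat_of_bool.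
  by apply/eqP/eqP => [/bits_inj|->].
move=> v vz; rewrite !mxE; have /negPf -> : bits v != flip i (bits z).
  by apply: contraNneq vz => <-; rewrite bitsK.
by rewrite mulr0.
Qed.

Definition transverse (i : 'I_n) : 'M[C]_N := 2^-1 *: (1%:M - sigmax R i).

Definition cost_mx (W : 'I_N -> nat) (pi : 'S_N) : 'M[C]_N :=
  diag_mx (\row_z (W ((pi^-1)%g z))%:R).

(** The cost is a parameter so that the original and the raised Hamiltonian are both instances;
    [weight] gives back [hamiltonian]. *)
Definition hamiltonian_of (W : 'I_N -> nat) (pi : 'S_N) (s : R) : 'M[C]_N :=
  (1 - s)%:C%C *: (\sum_(i < n) transverse i) + s%:C%C *: cost_mx W pi.

Lemma transverse_hermsym i : transverse i \is hermsymmx.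
Proof.
apply: hermsymZ; first by rewrite realV realn.
apply: hermsymD; first exact: hermsym1.
by rewrite -scaleN1r hermsymZ ?realN ?real1 // sigmax_hermsym.
Qed.

Lemma transverse_idem i : transverse i *m transverse i = transverse i.
Proof.
rewrite -scalemxAl -scalemxAr scalerA mulmxBl !mulmxBr sigmax_sqr !mul1mx mulmx1.
set S := sigmax R i.
have -> : 1%:M - S - (S - 1%:M) = 2 *: (1%:M - S).
  by rewrite opprB scaler_nat mulr2n -opprB.
by rewrite scalerA -mulrA mulVf ?mulr1 // pnatr_eq0.
Qed.

(** Since [transverse i] is an orthogonal projector, the form and its complement are the squared
    norms of the two projections of [x]. *)
Lemma transverse_bounds i (x : 'rV[C]_N) :
  0 <= '[x *m transverse i, x] <= '[x].
Proof.
have h := transverse_hermsym i.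
have E : '[x *m transverse i, x] = '[x *m transverse i].
  by rewrite -{1}transverse_idem mulmxA dotmx_mul_hermsym.
rewrite E dnorm_ge0 /= -subr_ge0.
suff -> : '[x] - '[x *m transverse i] = '[x - x *m transverse i] by exact: dnorm_ge0.
by rewrite linearBl /= !linearBr /= -E -(dotmx_mul_hermsym x x) // subrr subr0.
Qed.

Lemma hamiltonian_of_hermsym W pi s : hamiltonian_of W pi s \is hermsymmx.
Proof.
have real_real (a : R) : (a%:C%C : C) \is Num.real by apply/complex_realP; exists a.
apply: hermsymD; apply: hermsymZ => //.
  by apply: hermsym_sum => i; exact: transverse_hermsym.
by apply/hermsym_diag/mxOverP => i j; rewrite mxE realn.
Qed.

Lemma transverse_sum_bounds (x : 'rV[C]_N) :
  0 <= '[x *m \sum_(i < n) transverse i, x] <= n%:R * '[x].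
Proof.
rewrite mulmx_sumr linear_sumlz /=; apply/andP; split.
  by apply: sumr_ge0 => i _; case/andP: (transverse_bounds i x).
have -> : n%:R * '[x] = \sum_(i < n) '[x].
  by rewrite sumr_const card_ord mulr_natl.
apply: ler_sum => i _.
by case/andP: (transverse_bounds i x).
Qed.

Lemma potential_bounds (W : 'I_N -> nat) (pi : 'S_N) (a b : nat) (x : 'rV[C]_N) :
  (forall z, a <= W z <= b)%N ->
  a%:R * '[x] <= '[x *m cost_mx W pi, x] <= b%:R * '[x].
Proof.
move=> Wab; rewrite dotmx_diag dotmx_sum !mulr_sumr.
by apply/andP; split; apply: ler_sum => j _; rewrite mxE ler_wpM2r ?exprn_ge0 //
  ler_nat; case/andP: (Wab ((pi^-1)%g j)).
Qed.

(** The difference of the Hamiltonians is [s - t] times cost minus transverse part, and both of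
    these forms lie between 0 and [n]. *)
Lemma ground_energy_lipschitz (W : 'I_N -> nat) (pi : 'S_N) (s t : R) :
  (forall z, W z <= n)%N ->
  (eigenvalues (hamiltonian_of W pi s))`_0 <=
    (eigenvalues (hamiltonian_of W pi t))`_0 + n%:R * `|s - t|.
Proof.
move=> Wn; apply: ground_energy_le; rewrite ?hamiltonian_of_hermsym ?expn_gt0 //.
move=> x; set L := \sum_(i < n) transverse i.
set D := cost_mx W pi.
have -> : hamiltonian_of W pi s - hamiltonian_of W pi t = (s - t)%:C%C *: (D - L).
  rewrite /hamiltonian_of -/L -/D; move: L D => L D.
  by apply/matrixP => i j; rewrite !mxE !rmorphB; ring.
have /andP[l0 ln] := transverse_sum_bounds x; rewrite -/L in l0 ln.
have /andP[] := @potential_bounds W pi 0 n x (fun z => Wn z).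
rewrite -/D mul0r => d0 dn.
rewrite -scalemxAr linearZl_LR /= mulmxBr linearBl /=.
have nE (a : R) : (n%:R * a)%:C%C * '[x] = a%:C%C * (n%:R * '[x]) :> C.
  by rewrite rmorphM rmorph_nat; ring.
case: (leP 0 (s - t)) => st; rewrite nE.
  rewrite ger0_norm // ler_wpM2l ?ler0c //; apply: le_trans dn.
  by rewrite gerBl.
rewrite ltr0_norm // -(opprB t s) opprK rmorphN mulNr -mulrN opprB ler_wpM2l //.
  by rewrite ler0c -oppr_le0 opprB ltW.
by apply: le_trans ln; rewrite gerBl.
Qed.

(** Puts the raised Hamiltonian in the form required by [gap_rank_one], with [lam = s * c]. *)
Lemma hamiltonian_of_raise (W W' : 'I_N -> nat) (pi : 'S_N) z0 c s :
  (forall z, W' z = W z + c * (z == z0))%N ->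
  hamiltonian_of W' pi s =
    hamiltonian_of W pi s + (s * c%:R)%:C%C *: delta_mx (pi z0) (pi z0).
Proof.
move=> W'E; rewrite /hamiltonian_of -addrA; congr (_ + _).
have -> : (s * c%:R)%:C%C = s%:C%C * c%:R :> C by rewrite rmorphM rmorph_nat.
rewrite -scalerA -scalerDr; congr (_ *: _).
apply/matrixP => i j; rewrite !mxE W'E natrD mulrnDl natrM; congr (_ + _).
have [<-|ij] := eqVneq i j; last first.
  have -> : (i == pi z0) && (j == pi z0) = false.
    by apply: contraNF ij => /andP[/eqP -> /eqP ->].
  by rewrite mulr0n mulr0.
rewrite mulr1n andbb; congr (_ * _%:R); congr nat_of_bool.
by rewrite -(inj_eq (@perm_inj _ pi)) permKV.
Qed.

Lemma hamiltonian_of_start W W' (pi : 'S_N) :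
  hamiltonian_of W pi 0 = hamiltonian_of W' pi 0.
Proof. by rewrite /hamiltonian_of !scale0r. Qed.

(** At [s = 1] only the diagonal cost is left, and all its entries are at least 1. *)
Lemma ground_energy_end_ge (W : 'I_N -> nat) (pi : 'S_N) :
  (forall z, 0 < W z)%N -> 1 <= (eigenvalues (hamiltonian_of W pi 1))`_0.
Proof.
move=> W0; have h := hamiltonian_of_hermsym W pi 1.
have [phi [phi1 phiE _ _]] := ground_state h (expn_gt0 2 n).
have := congr1 (fun z => '[z, phi]) phiE.
rewrite /= linearZl_LR /= phi1 mulr1 -lecR => <-.
rewrite /hamiltonian_of subrr scale0r add0r scale1r.
have Wn z : (1 <= W z <= \max_z W z)%N by rewrite W0 leq_bigmax.
by have /andP[] := @potential_bounds W pi 1 _ phi Wn; rewrite phi1 mulr1.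
Qed.

(** The basis vector at [pi z0] is a trial state of energy 0. *)
Lemma ground_energy_end_le (W : 'I_N -> nat) (pi : 'S_N) z0 :
  W z0 = 0%N -> (eigenvalues (hamiltonian_of W pi 1))`_0 <= 0.
Proof.
move=> W0; have h := hamiltonian_of_hermsym W pi 1.
have [_ [_ _ /(_ (delta_mx 0 (pi z0))) rq _]] := ground_state h (expn_gt0 2 n).
move: rq; rewrite /hamiltonian_of subrr scale0r add0r scale1r.
rewrite dotmx_diag dotmx_sum.
have sumd (f : 'I_N -> C) :
    \sum_j f j * `|(delta_mx 0 (pi z0) : 'rV[C]_N) 0 j| ^+ 2 = f (pi z0).
  rewrite (bigD1 (pi z0)) //= big1 ?addr0 => [|j jz].
    by rewrite mxE !eqxx normr1 expr1n mulr1.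
  by rewrite mxE (negPf jz) andbF normr0 expr0n mulr0.
rewrite sumd mxE permK W0.
under eq_bigr do rewrite -[_ ^+ 2]mul1r.
by rewrite (sumd (fun=> 1)) mulr1 lecR.
Qed.

End Hamiltonians.

(** * Level crossing along the net *)

Section Crossing.
Variables (R : realType) (n : nat).
Local Notation N := (2 ^ n)%N.
Local Notation C := R[i]%C.
Local Notation z0 := (zero_string n).
Local Notation energy A := (eigenvalues A)`_0.

(** The choice depends on the matrix alone, so permutations with equal raised Hamiltonians get the
    same vector even if the ground energy is degenerate. By [groundP], the default 0 does not arise
    for a Hermitian matrix of positive dimension. *)
Definition ground m (A : 'M[C]_m) : 'rV[C]_m :=
  xget 0 [set phi | '[phi] = 1 /\ phi *m A = (energy A)%:C%C *: phi].

Lemma groundP m (A : 'M[C]_m) : A \is hermsymmx -> (0 < m)%N ->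
  '[ground A] = 1 /\ ground A *m A = (energy A)%:C%C *: ground A.
Proof.
move=> hA m0; rewrite /ground; case: xgetP => [phi _ //|].
by have [phi [phi1 phiA _ _]] := ground_state hA m0 => /(_ phi); case.
Qed.

Lemma dim_gt1 : (0 < n)%N -> (1 < N)%N.
Proof. by move=> n0; rewrite (@ltn_exp2l 2 0). Qed.

(** Supplies the lower bound that makes the infimum in [min_gap] meaningful. For [0 < n] the
    dimension is at least 2, so index 1 holds a true eigenvalue. *)
Lemma gap_ge0 (pi : 'S_N) s : (0 < n)%N -> 0 <= gap pi s :> R.
Proof.
by move=> n0; rewrite subr_ge0; apply: eigenvalues_le; exact: dim_gt1.
Qed.

Lemma min_gap_le_gap (pi : 'S_N) (s : R) :
  (0 < n)%N -> 0 <= s <= 1 -> min_gap R pi <= gap pi s.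
Proof.
move=> n0 s01; apply: ge_inf; last by exists s => //; rewrite /= in_itv.
by exists 0 => _ [t _ <-]; exact: gap_ge0.
Qed.

(* The strings of raised weight [c], zero string included, are interchangeable
   for the raised Hamiltonian. *)
Definition raised_weight (c : nat) (z : 'I_N) : nat :=
  (weight z + c * (z == z0))%N.

Definition raised_hamiltonian c (pi : 'S_N) (s : R) : 'M[C]_N :=
  hamiltonian_of (raised_weight c) pi s.

Lemma raised_weight_bounds c z : (0 < c <= n)%N -> (0 < raised_weight c z <= n)%N.
Proof.
rewrite /raised_weight; have [->|zz] := eqVneq z z0.
  by rewrite weight_zero add0n muln1.
by rewrite muln0 addn0 weight_gt0 // weight_le.
Qed.

Lemma diff_step (a a' e e' x : R) :
  a' <= a + x -> e <= e' + x -> a' - e' <= a - e + 2 * x.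
Proof. lra. Qed.

Lemma min_gap_net (pi : 'S_N) (c M : nat) (b : R) :
  (0 < c <= n)%N -> (0 < M)%N -> 0 < b -> 2 * n%:R * b <= 1 ->
  (forall k : 'I_M.+1,
    `|ground (raised_hamiltonian c pi (k%:R / M%:R)) 0 (pi z0)| ^+ 2
      <= (b ^+ 2)%:C%C) ->
  min_gap R pi <= 2 * (2 * n%:R * b + 2 * n%:R / M%:R).
Proof.
move=> c0n M0 b0 nb1 small.
have n0 : (0 < n)%N by case/andP: c0n => /leq_trans; apply.
have M0R : 0 < M%:R :> R by rewrite ltr0n.
have W'n z : (raised_weight c z <= n)%N by case/andP: (raised_weight_bounds z c0n).
pose D k := energy (raised_hamiltonian c pi (k%:R / M%:R)) -
            energy (hamiltonian pi (k%:R / M%:R : R)).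
have D0 : D 0%N = 0.
  by rewrite /D mul0r /raised_hamiltonian (hamiltonian_of_start _ _ (@weight n)) subrr.
have DM : 1 <= D M.
  rewrite /D divff ?gt_eqF // lerBrDl -lerBrDr; apply: le_trans (_ : 0 <= _).
    exact: (@ground_energy_end_le R n (@weight n) pi z0 (weight_zero n)).
  rewrite subr_ge0; apply: ground_energy_end_ge => z.
  by case/andP: (raised_weight_bounds z c0n).
have DS k : D k.+1 <= D k + 2 * n%:R / M%:R.
  have step : `|k.+1%:R / M%:R - k%:R / M%:R| = M%:R^-1 :> R.
    by rewrite -mulrBl -natr1 addrAC subrr add0r mul1r gtr0_norm ?invr_gt0.
  rewrite /D -mulrA; apply: diff_step.
    have := ground_energy_lipschitz pi (k.+1%:R / M%:R : R) (k%:R / M%:R) W'n.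
    by rewrite step.
  have := ground_energy_lipschitz pi (k%:R / M%:R : R) (k.+1%:R / M%:R) (@weight_le n).
  by rewrite distrC step.
(* The threshold [2 * n%:R * b] is what [gap_rank_one] demands: there [lam = s * c] is at most [n]
   and the entry of [phi] at most [b]. *)
have exk : exists k, 2 * n%:R * b <= D k by exists M; exact: le_trans DM.
case: (ex_minnP exk) => k bk mink.
have kM : (k < M.+1)%N by rewrite ltnS; apply: mink; exact: le_trans DM.
have nb0 : 0 < 2 * n%:R * b by rewrite !mulr_gt0 // ltr0n.
(* At the first index past the threshold, either [k = 0] and [D] vanishes, or the preceding value is
   below the threshold and one step adds at most [2 * n%:R / M%:R]. *)
have Dk : D k <= 2 * n%:R * b + 2 * n%:R / M%:R.
  case: k bk mink kM => [|k] _ mink _.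
    by rewrite D0 addr_ge0 ?(ltW nb0) // divr_ge0 // mulr_ge0.
  apply: le_trans (DS k) _; rewrite lerD2r leNgt; apply/negP => /ltW /mink.
  by rewrite ltnn.
set s : R := k%:R / M%:R.
have s01 : 0 <= s <= 1.
  by rewrite divr_ge0 //= ler_pdivrMr // mul1r ler_nat.
apply: le_trans (min_gap_le_gap pi n0 s01) _.
apply: (@le_trans _ _ (2 * D k)); last by rewrite ler_pM2l.
have hH := hamiltonian_of_hermsym (@weight n) pi s.
have hH' := hamiltonian_of_hermsym (raised_weight c) pi s.
have [phi1 phiE] := groundP hH' (expn_gt0 2 n).
rewrite {2}(hamiltonian_of_raise pi s (fun z => erefl)) in phiE.
have sc : 0 <= s * c%:R <= n%:R.
  case/andP: s01 => s0 s1; rewrite mulr_ge0 //=.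
  apply: (@le_trans _ _ (1 * c%:R)); first by rewrite ler_wpM2r.
  by rewrite mul1r ler_nat; case/andP: c0n.
case/andP: sc => sc0 scn.
apply: (gap_rank_one hH (dim_gt1 n0) sc0 phi1 phiE).
  by rewrite -subr_gt0; exact: lt_le_trans bk.
apply: (@le_trans _ _ ((4 * (s * c%:R) ^+ 2)%:C%C * (b ^+ 2)%:C%C)).
  apply: ler_wpM2l; last exact: small (Ordinal kM).
  by rewrite ler0c mulr_ge0 // exprn_ge0.
rewrite -rmorphM lecR; apply: (@le_trans _ _ ((2 * n%:R * b) ^+ 2)).
  rewrite [leRHS](_ : _ = 4 * n%:R ^+ 2 * b ^+ 2); last by ring.
  by rewrite ler_wpM2r ?exprn_ge0 ?(ltW b0) // ler_pM2l // lerXn2r // nnegrE.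
by rewrite !expr2; exact: (ler_pM (ltW nb0) (ltW nb0) bk bk).
Qed.

(* Averaging over the swaps of [x0] with [S] replaces the value of [F pi] at
   [pi x0] by its mean over [pi @: S], to which Markov's inequality applies. *)
Lemma card_swap_invariant m (x0 : 'I_m) (S : {set 'I_m}) (B : R)
    (F : 'S_m -> 'I_m -> R) :
  0 <= B -> (forall pi z, 0 <= F pi z) -> (forall pi, \sum_z F pi z <= 1) ->
  (forall pi a, a \in S -> F (tperm x0 a * pi)%g = F pi) ->
  B * #|S|%:R * #|[pred pi : 'S_m | B < F pi (pi x0)]|%:R <= #|{: 'S_m}|%:R.
Proof.
move=> B0 F0 F1 Finv.
(* Left multiplication by the transposition permutes the group, fixes [F], and moves the evaluation
   point from [pi x0] to [pi a]. *)
have swap a : a \in S -> #|[pred pi : 'S_m | B < F pi (pi x0)]| =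
    #|[pred pi : 'S_m | B < F pi (pi a)]|.
  move=> aS; rewrite -!sum1_card (reindex_inj (mulgI (tperm x0 a))) /=.
  apply: eq_bigl => pi; rewrite !inE Finv //.
  by rewrite permM tpermL.
have -> : B * #|S|%:R * #|[pred pi : 'S_m | B < F pi (pi x0)]|%:R =
    \sum_(pi : 'S_m) \sum_(a in S) B * ((B < F pi (pi a))%R)%:R.
  rewrite exchange_big /= -mulrA mulr_natl -sumr_const mulr_sumr.
  apply: eq_bigr => a aS; rewrite (swap a aS) -mulr_sumr; congr (_ * _).
  rewrite -sum1_card natr_sum [LHS]big_mkcond /=; apply: eq_bigr => pi _.
  by rewrite inE; case: ifP.
rewrite -sum1_card natr_sum; apply: ler_sum => pi _.
apply: le_trans (F1 pi).
(* Markov's inequality for a fixed [pi]: restrict the total mass of [F pi] to the images of [S]. *)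
rewrite [leRHS](reindex_inj (@perm_inj _ pi)) [leRHS](bigID (mem S)) /=.
apply: ler_wpDr; first exact: sumr_ge0.
apply: ler_sum => a _; have [Ba|_] := boolP ((B < F pi (pi a))%R).
  by rewrite mulr1 ltW.
by rewrite mulr0.
Qed.

(** Pigeonhole: every string lies in at least one of the [n] classes; the zero string lies in all of
    them, because its raised weight is [c] itself. *)
Lemma popular_weight : (0 < n)%N -> exists2 c, (0 < c <= n)%N &
  (N <= n * #|[set z : 'I_N | raised_weight c z == c]%SET|)%N.
Proof.
move=> n0.
suff [c] : exists c : 'I_n,
    (N <= n * #|[set z : 'I_N | raised_weight c.+1 z == c.+1]%SET|)%N.
  by exists c.+1 => //=.
apply/existsP; apply: contraT; rewrite negb_exists => /forallP small.
have cover : (N <= \sum_(c < n) #|[set z : 'I_N | raised_weight c.+1 z == c.+1]%SET|)%N.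
  under eq_bigr do rewrite -sum1_card.
  rewrite (exchange_big_dep xpredT) //= -{1}[N]card_ord -sum1_card.
  apply: leq_sum => z _.
  suff [c zc] : exists c : 'I_n, raised_weight c.+1 z = c.+1.
    by rewrite (bigD1 c) // inE zc.
  rewrite /raised_weight; have [->|zz] := eqVneq z z0.
    by exists (Ordinal n0); rewrite weight_zero muln1.
  have wz : ((weight z).-1 < n)%N by rewrite prednK ?weight_le ?weight_gt0.
  by exists (Ordinal wz); rewrite muln0 addn0 /= prednK ?weight_gt0.
(* If every class were too small, [n] times its size would be at most [N - 1]; summing over the
   classes contradicts [cover]. *)
have : (n * N <= n * N.-1)%N.
  apply: leq_trans
    (_ : n * \sum_(c < n) #|[set z : 'I_N | raised_weight c.+1 z == c.+1]%SET| <= _)%N.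
    by rewrite leq_mul2l cover orbT.
  have -> : (n * N.-1 = \sum_(c < n) N.-1)%N by rewrite sum_nat_const card_ord.
  rewrite big_distrr /=; apply: leq_sum => c _.
  by rewrite -ltnS prednK ?expn_gt0 // ltnNge small.
by rewrite leq_mul2l eqn0Ngt n0 /= leqNgt prednK ?expn_gt0 ?leqnn.
Qed.

End Crossing.

(** * Probabilities *)

(** Union bound over the [M + 1] net points. Each is bad with probability at most
    [n / (b ^ 2 * 2 ^ n)], as the popular class has at least [2 ^ n / n] strings. *)
Lemma prob_min_gap (R : realType) (n M : nat) (b : R) :
  (0 < n)%N -> (0 < M)%N -> 0 < b -> 2 * n%:R * b <= 1 ->
  1 - M.+1%:R * n%:R / (b ^+ 2 * 2 ^+ n) <=
  prob_perm R [pred pi : 'S_(2 ^ n) |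
    min_gap R pi <= 2 * (2 * n%:R * b + 2 * n%:R / M%:R)].
Proof.
move=> n0 M0 b0 nb1; set good := [pred pi | _].
have [c c0n cS] := popular_weight n0.
set S : {set 'I_(2 ^ n)} := [set z | _]%SET in cS.
pose phi k (pi : 'S_(2 ^ n)) := ground (raised_hamiltonian c pi (k%:R / M%:R : R)).
pose F k pi z := complex.Re (`|phi k pi 0 z| ^+ 2).
have FE k pi z : `|phi k pi 0 z| ^+ 2 = (F k pi z)%:C%C.
  by rewrite RRe_real // ger0_real // exprn_ge0.
have F0 k pi z : 0 <= F k pi z by rewrite -lecR -FE exprn_ge0.
have F1 k pi : \sum_z F k pi z <= 1.
  rewrite -lecR rmorph_sum /=; under eq_bigr do rewrite -FE.
  have h := hamiltonian_of_hermsym (raised_weight c) pi (k%:R / M%:R : R).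
  by rewrite -dotmx_sum; have [-> _] := groundP h (expn_gt0 2 n).
(* All strings of [S], the zero string included, have raised weight [c], so swapping two of them
   leaves the raised Hamiltonian, hence [ground], unchanged. *)
have raised_swap pi a : a \in S ->
    (fun z => raised_weight c (((tperm (zero_string n) a * pi)^-1)%g z)) =1
    (fun z => raised_weight c ((pi^-1)%g z)).
  rewrite inE => /eqP aS z; rewrite invMg tpermV permM.
  have z0S : raised_weight c (zero_string n) = c.
    by rewrite /raised_weight weight_zero eqxx muln1.
  by case: tpermP => [->|->|//]; rewrite aS z0S.
have Finv k pi a : a \in S -> F k (tperm (zero_string n) a * pi)%g = F k pi.
  move=> aS; apply/funext => z; rewrite /F /phi.
  congr (complex.Re (`|ground _ 0 z| ^+ 2)).
  rewrite /raised_hamiltonian /hamiltonian_of; congr (_ + _ *: diag_mx _).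
  by apply/rowP => j; rewrite !mxE raised_swap.
pose bad k := [pred pi : 'S_(2 ^ n) | b ^+ 2 < F k pi (pi (zero_string n))].
have cover : (#|[predC good]| <= \sum_(k < M.+1) #|bad k|)%N.
  under [leqRHS]eq_bigr do rewrite -sum1_card.
  rewrite (exchange_big_dep xpredT) //= -sum1_card [leqLHS]big_mkcond /=.
  apply: leq_sum => pi _; case: ifP => // ngood.
  suff [k kbad] : exists k : 'I_M.+1, pi \in bad k by rewrite (bigD1 k).
  apply/existsP; apply: contraLR ngood; rewrite negb_exists inE negbK => /forallP nbad.
  apply: (min_gap_net c0n M0 b0 nb1) => k.
  by rewrite -/(phi k pi) FE lecR leNgt; have := nbad k; rewrite inE.
have fact0 : 0 < #|{: 'S_(2 ^ n)}|%:R :> R.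
  by rewrite ltr0n; apply/card_gt0P; exists 1%g.
have N0 : 0 < b ^+ 2 * 2 ^+ n :> R by rewrite mulr_gt0 ?exprn_gt0.
have few k : b ^+ 2 * 2 ^+ n * #|bad k|%:R <= n%:R * #|{: 'S_(2 ^ n)}|%:R.
  have B0 : 0 <= b ^+ 2 by rewrite exprn_ge0 // ltW.
  have := card_swap_invariant B0 (F0 k) (F1 k) (Finv k).
  move=> /(ler_wpM2l (ler0n R n)); apply: le_trans.
  rewrite [leRHS](_ : _ = b ^+ 2 * (n%:R * #|S|%:R) * #|bad k|%:R); last by ring.
  by rewrite ler_wpM2r // ler_wpM2l // -natrX -natrM ler_nat.
have total : #|[predC good]|%:R * (b ^+ 2 * 2 ^+ n) <=
    M.+1%:R * n%:R * #|{: 'S_(2 ^ n)}|%:R :> R.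
  apply: le_trans (_ : (\sum_(k < M.+1) #|bad k|)%:R * (b ^+ 2 * 2 ^+ n) <= _).
    by rewrite ler_pM2r // ler_nat.
  rewrite natr_sum mulr_suml -mulrA [leRHS]mulr_natl.
  have -> : (n%:R * #|{: 'S_(2 ^ n)}|%:R) *+ M.+1 =
      \sum_(k < M.+1) n%:R * #|{: 'S_(2 ^ n)}|%:R :> R by rewrite sumr_const card_ord.
  by apply: ler_sum => k _; rewrite mulrC few.
rewrite /prob_perm ler_pdivlMr // mulrBl mul1r lerBlDr.
rewrite -[X in X%:R <= _](cardC good) natrD lerD2l.
by rewrite mulrAC ler_pdivlMr.
Qed.

(** * Choice of parameters and the limit *)

Lemma powR2_ge (R : realType) (n : nat) : 1 + n%:R / 12 * ln 2 <= 2 `^ (n%:R / 12) :> R.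
Proof. by rewrite /powR pnatr_eq0 /=; exact: expR_ge1Dx. Qed.

(** With [p = 2 ^ (n / 12)] the exponentials become integer powers of [p]: the target gap is
    [n ^ 2 * p ^- 2], and the failure bound is at most [640 * n ^ 3 * p ^- 6]. The linear bound
    [p >= n * ln 2 / 12] turns the latter into a multiple of [n ^- 3], which is more than enough. *)
Lemma prob_min_gap_ge (R : realType) (n : nat) : (0 < n)%N ->
  1 - 1280 * (12 / ln 2) ^+ 6 * n.+1%:R^-1 <=
  prob_perm R [pred pi : 'S_(2 ^ n) |
    min_gap R pi <= n%:R ^+ 2 * 2 `^ (- (n%:R / 6))].
Proof.
move=> n0; pose p : R := 2 `^ (n%:R / 12).
have nR : 1 <= n%:R :> R by rewrite ler1n.
have ln2 : 0 < ln 2 :> R by rewrite ln_gt0 // ltr1n.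
have pln : n%:R * (ln 2 / 12) <= p.
  by apply: le_trans (powR2_ge R n); rewrite mulrA mulrAC lerDr.
have p1 : 1 <= p.
  by apply: le_trans (powR2_ge R n); rewrite lerDl mulr_ge0 ?divr_ge0 // ltW.
have p0 : 0 < p by exact: lt_le_trans p1.
have pX k : 2 `^ (n%:R / 12 * k%:R) = p ^+ k by rewrite powRrM powR_mulrn ?ltW.
clearbody p.
have -> : 2 `^ (- (n%:R / 6)) = p ^- 2 :> R.
  by rewrite powRN -pX; congr (_ `^ _)^-1; field.
have p12 : 2 ^+ n = p ^+ 12 :> R.
  by rewrite -pX -powR_mulrn //; congr (_ `^ _); field.
(* These values make [2 * n * b] equal to [p ^- 2 / 4] and [2 * n / M] at most [n * p ^- 2 / 4], so
   twice their sum is at most [n * p ^- 2]. *)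
pose b := p ^- 2 / (8 * n%:R); pose M := (Num.truncn (8 * p ^+ 2)).+1.
have n0R : 0 < n%:R :> R by exact: lt_le_trans nR.
have p20 : 0 < p ^- 2 by rewrite invr_gt0 exprn_gt0.
have p21 : p ^- 2 <= 1 by rewrite invf_le1 ?exprn_gt0 // exprn_ege1.
have b0 : 0 < b by rewrite divr_gt0 // mulr_gt0.
have nbE : 2 * n%:R * b = p ^- 2 / 4.
  by rewrite /b; field; rewrite !gt_eqF.
have nb1 : 2 * n%:R * b <= 1 by rewrite nbE; lra.
have M8 : 8 * p ^+ 2 <= M%:R by rewrite ltW // truncnS_gt.
have MS : M.+1%:R <= 10 * p ^+ 2.
  have t8 : (Num.truncn (8 * p ^+ 2))%:R <= 8 * p ^+ 2.
    by rewrite truncn_le // mulr_ge0 // exprn_ge0 // ltW.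
  have p2 : 1 <= p ^+ 2 by rewrite exprn_ege1.
  (* One unit comes from rounding up and one from the extra net point; [2 * p ^ 2] absorbs both. *)
  have -> : M.+1%:R = (Num.truncn (8 * p ^+ 2))%:R + 2 :> R by rewrite -natrD addn2.
  by apply: le_trans (lerD t8 (_ : 2 <= 2 * p ^+ 2)) _; lra.
have target : 2 * (2 * n%:R * b + 2 * n%:R / M%:R) <= n%:R ^+ 2 * p ^- 2.
  have : 2 * n%:R / M%:R <= n%:R * p ^- 2 / 4.
    rewrite ler_pdivrMr ?ltr0n //.
    apply: (@le_trans _ _ (n%:R * p ^- 2 / 4 * (8 * p ^+ 2))).
      by rewrite le_eqVlt; apply/orP; left; apply/eqP; field; rewrite gt_eqF.
    by rewrite ler_wpM2l // divr_ge0 // mulr_ge0 // ltW.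
  rewrite nbE; move: (2 * n%:R / M%:R) (p ^- 2) p20 => x y y0 xy.
  have := ler_wpM2r (ltW y0) nR; nra.
have := prob_min_gap n0 (ltn0Sn _ : (0 < M)%N) b0 nb1.
set good := [pred pi | _] => Pgood.
apply: (@le_trans _ _ (prob_perm R good)); last first.
  rewrite /prob_perm ler_wpM2r ?invr_ge0 // ler_nat.
  apply/subset_leq_card/fintype.subsetP => pi.
  by rewrite !inE => /le_trans; apply.
apply: le_trans Pgood; rewrite lerD2l lerN2.
pose l : R := ln 2 / 12; have l0 : 0 < l by rewrite divr_gt0.
have nl0 : 0 < n%:R * l by rewrite mulr_gt0.
have -> : 12 / ln 2 = l^-1 :> R by rewrite invf_div.
rewrite p12 (_ : b ^+ 2 * p ^+ 12 = p ^+ 8 / (64 * n%:R ^+ 2)); last first.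
  by rewrite /b; field; rewrite !gt_eqF.
apply: (@le_trans _ _ (10 * p ^+ 2 * n%:R / (p ^+ 8 / (64 * n%:R ^+ 2)))).
  by rewrite ler_wpM2r ?invr_ge0 ?divr_ge0 ?ler_wpM2r // ?mulr_ge0 ?exprn_ge0
    ?(ltW p0).
have -> : 10 * p ^+ 2 * n%:R / (p ^+ 8 / (64 * n%:R ^+ 2)) =
    640 * n%:R ^+ 3 * p ^- 6.
  by field; rewrite !gt_eqF.
apply: (@le_trans _ _ (640 * n%:R ^+ 3 * (n%:R * l) ^- 6)).
  apply: (ler_wpM2l (mulr_ge0 (ler0n _ 640) (exprn_ge0 3 (ler0n _ n)))).
  by rewrite lef_pV2 ?posrE ?exprn_gt0 // lerXn2r // nnegrE ltW.
have -> : 640 * n%:R ^+ 3 * (n%:R * l) ^- 6 = l^-1 ^+ 6 * (640 * n%:R ^- 3).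
  by field; rewrite !gt_eqF.
(* The factor 1280 is twice 640, since [n + 1 <= 2 * n]; this matches the shifted index of
   [harmonic]. *)
rewrite [leRHS](_ : _ = l^-1 ^+ 6 * (1280 * n.+1%:R^-1)); last by ring.
rewrite ler_wpM2l ?exprn_ge0 ?invr_ge0 ?(ltW l0) //.
rewrite ler_pdivrMr ?exprn_gt0 // mulrAC ler_pdivlMr ?ltr0n //.
apply: (@le_trans _ _ (640 * (2 * n%:R))).
  by apply: (ler_wpM2l (ler0n _ 640)); rewrite -natr1; lra.
rewrite mulrA -natrM; apply: (ler_wpM2l (ler0n _ _)).
by rewrite [leRHS]exprS ler_peMr ?exprn_ege1.
Qed.

Theorem theorem2 (R : realType) :
  (fun n : nat =>
     prob_perm R [pred pi : 'S_(2 ^ n)%N |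
       min_gap R pi <= n%:R ^+ 2 * 2 `^ (- (n%:R / 6))])
  @ \oo --> (1 : R).
Proof.
(* Squeeze between the lower bound, valid once [n] is positive, and the trivial upper bound 1. *)
apply: (@squeeze_cvgr _ _ _ _
  (fun n => 1 - 1280 * (12 / ln 2) ^+ 6 * harmonic n) (fun=> 1)); last exact: cvg_cst.
  near=> n; rewrite prob_min_gap_ge /=; last by near: n; exact: nbhs_infty_gt.
  rewrite /prob_perm ler_pdivrMr ?mul1r ?ler_nat ?max_card //.
  by rewrite ltr0n; apply/card_gt0P; exists 1%g.
rewrite -[X in _ --> X]subr0 -(mulr0 (1280 * (12 / ln 2) ^+ 6)).
by apply: cvgB; [exact: cvg_cst | apply: cvgMr; exact: cvg_harmonic].
Unshelve. all: by end_near.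
Qed.
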